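(* Let $A$ be an Artin algebra. If $A$ is $n$-Gorenstein, then $\mathrm{Dell}(A)=n$.
   Context: Modules are right modules; $\mathrm{mod}\,A$ is the category of finitely generated right $A$-modules and $\underline{\mathrm{mod}}\,A$ its stable category (modulo projectives). $\Omega(M)$ is the syzygy of $M$ (kernel of a projective cover), $\Omega^0(M)=M$, $\Omega^{n+1}(M)=\Omega(\Omega^n(M))$. For $M\in\mathrm{mod}\,A$, $\mathrm{dell}(M)=\inf\{n\ge 0:\Omega^n(M)$ is a direct summand of $\Omega^{n+1}(N)$ in $\underline{\mathrm{mod}}\,A$ for some $N\in\mathrm{mod}\,A\}$, with $\mathrm{dell}(M)=\infty$ if no such $n$ exists. The global delooping level is $\mathrm{Dell}(A)=\sup\{\mathrm{dell}(M): M\in\mathrm{mod}\,A\}$. $A$ is Gorenstein if $A_A$ and ${}_AA$ both have finite injective dimension (the two dimensions are then equal); $A$ is $n$-Gorenstein means this common injective dimension is $n$ (that is, $n$ is taken minimal). *)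

(* Defs.v *)
From mathcomp Require Import all_boot all_algebra.
From mathcomp Require Import boolp classical_sets.

Set Implicit Arguments.
Unset Strict Implicit.
Unset Printing Implicit Defensive.

Import GRing.Theory.
Local Open Scope ring_scope.

(* Natural numbers with infinity: [Some n] is n and [None] is infinity. *)
Definition enat := option nat.

Definition enat_inf (S : set nat) : enat :=
  if pselect (exists n, `[< S n >]) is left S_neq0
  then Some (ex_minn S_neq0) else None.

Definition enat_le_nat (d : enat) (n : nat) : bool :=
  if d is Some m then (m <= n)%N else false.

(* The least upper bound, infinite when no natural number is an upper bound. *)
Definition enat_sup (S : set enat) : enat :=
  enat_inf [set n | forall d, S d -> enat_le_nat d n].

(* Modules over a ring S are [lmodType S]; right A-modules are left modules    *)
(* over the opposite ring A^c.                                                *)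

Definition finitely_generated (S : pzRingType) (V : lmodType S) : Prop :=
  exists (m : nat) (e : 'I_m -> V),
    forall v, exists c : 'I_m -> S, v = \sum_(i < m) c i *: e i.

Definition surjective (X Y : Type) (f : X -> Y) : Prop :=
  forall y, exists x, f x = y.

Definition exact (S : pzRingType) (X Y Z : lmodType S)
    (f : {linear X -> Y}) (g : {linear Y -> Z}) : Prop :=
  forall y, g y = 0 <-> exists x, f x = y.

Definition projective (S : pzRingType) (P : lmodType S) : Prop :=
  forall (X Y : lmodType S) (g : {linear X -> Y}) (h : {linear P -> Y}),
    surjective g -> exists k : {linear P -> X}, forall p, g (k p) = h p.

Definition injective_module (S : pzRingType) (E : lmodType S) : Prop :=
  forall (X Y : lmodType S) (i : {linear X -> Y}) (h : {linear X -> E}),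
    injective i -> exists k : {linear Y -> E}, forall x, k (i x) = h x.

(* A submodule N with N + ker f = P, for f : P -> M, must be all of P.         *)
Definition superfluous_kernel (S : pzRingType) (P M : lmodType S)
    (f : {linear P -> M}) : Prop :=
  forall N : {pred P}, submod_closed N ->
    (forall x, exists2 y, y \in N & f (x - y) = 0) -> forall x, x \in N.

Definition projective_cover (S : pzRingType) (P M : lmodType S)
    (f : {linear P -> M}) : Prop :=
  [/\ finitely_generated P, projective P, surjective f
    & superfluous_kernel f].

(* Syzygies are defined up to isomorphism: [syzygy M K] says that K is (the    *)
(* source of) a kernel of some projective cover of M.                         *)
Definition syzygy (S : pzRingType) (M K : lmodType S) : Prop :=
  exists (P : lmodType S) (f : {linear P -> M}) (i : {linear K -> P}),
    [/\ projective_cover f, injective i & exact i f].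

Fixpoint iter_syzygy (S : pzRingType) (n : nat) (M K : lmodType S) : Prop :=
  if n is m.+1 then exists2 L, iter_syzygy m M L & syzygy L K else K = M.

(* Equality of morphisms in the stable category: the difference factors       *)
(* through a finitely generated projective module.                            *)
Definition stable_eq (S : pzRingType) (X Y : lmodType S)
    (f g : {linear X -> Y}) : Prop :=
  exists (P : lmodType S) (u : {linear X -> P}) (v : {linear P -> Y}),
    [/\ finitely_generated P, projective P
      & forall x, f x - g x = v (u x)].

Definition stable_iso (S : pzRingType) (X Y : lmodType S) : Prop :=
  exists (f : {linear X -> Y}) (g : {linear Y -> X}),
    stable_eq (g \o f) idfun /\ stable_eq (f \o g) idfun.

Definition stable_direct_summand (S : pzRingType) (X Y : lmodType S) : Prop :=
  exists Z : lmodType S,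
    finitely_generated Z /\ stable_iso (X * Z)%type Y.

Definition dell (S : pzRingType) (M : lmodType S) : enat :=
  enat_inf [set n | exists N K L : lmodType S,
    [/\ finitely_generated N, iter_syzygy n M K, iter_syzygy n.+1 N L
      & stable_direct_summand K L]].

Definition Dell (A : pzRingType) : enat :=
  enat_sup [set d | exists2 M : lmodType A^c,
    finitely_generated M & d = dell M].

(* An exact sequence 0 -> M -> I 0 -> I 1 -> ... of injective modules I i,     *)
(* with I i = 0 for i > n.                                                    *)
Definition injective_resolution (S : pzRingType) (M : lmodType S) (n : nat) :
    Prop :=
  exists (I : nat -> lmodType S) (eps : {linear M -> I 0%N})
         (d : forall i, {linear I i -> I i.+1}),
    [/\ injective eps, exact eps (d 0%N), forall i, exact (d i) (d i.+1),
        forall i, injective_module (I i)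
      & forall i, (n < i)%N -> forall x : I i, x = 0].

Definition injdim (S : pzRingType) (M : lmodType S) : enat :=
  enat_inf [set n | injective_resolution M n].

Definition n_Gorenstein (A : pzRingType) (n : nat) : Prop :=
  injdim (A^c)^o = Some n /\ injdim A^o = Some n.

Definition artinian (R : comPzRingType) : Prop :=
  forall I : nat -> {pred R^o},
    (forall k, submod_closed (I k)) -> (forall k, {subset I k.+1 <= I k}) ->
    exists m, forall k, (m <= k)%N -> I k =i I m.

Definition artin_algebra (R : comPzRingType) (A : algType R) : Prop :=
  artinian R /\ finitely_generated A.

(* Main.v *)
From HB Require Import structures.
Require Import Defs.
From mathcomp Require Import all_boot all_algebra generic_quotient.
From mathcomp Require Import boolp classical_sets.

(** Write Ext for Ext(-, A), computed from the given injective coresolutions.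

    Lower bound. Suppose that [m < n] bounds all delooping levels. For [M] finitely
    generated, some syzygy K = Omega^k(M) with [k <= m] is a stable summand of an
    L = Omega^(k+1)(N). Dimension shifting gives
    Ext^n(M) = Ext^(n-k)(K), a summand of Ext^(n-k)(L) = Ext^(n+1)(N) = 0. By Baer's
    criterion the injective coresolution of [A] can then be cut one step earlier
    ([injective_resolution_shorten]), contradicting the minimality of [n].

    Upper bound. Let K = Omega^n(M). Then Ext^j(K) = Ext^(j+n)(M) = 0 for [j > 0], and
    it is shown that [K] is an (n+1)-st syzygy of some [N], along finitely generated
    free modules. The argument takes place in a complex of matrices, acting on columns
    for right modules and on rows for left modules. Let [B] be the matrix of a free
    presentation of [K] and [M'] its cokernel on the other side. Extending [B] to a
    free resolution of [K] and dualizing, the vanishing on [K] shows that [M'] is an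
    [n]-th syzygy, so that Ext vanishes on [M'] by the Gorenstein condition on the
    other side ([transpose_ext_vanish]). Extending the dual complex to a free
    resolution of [M'] and dualizing back then exhibits [K] as an iterated syzygy
    ([iterated_cosyzygy_ex]). As syzygies are stably independent of the presentations
    used ([stable_iso_iter_syzygy]), [K] is stably isomorphic to Omega^(n+1)(N).

    All of this needs the algebra to be noetherian on both sides and finitely generated
    modules to have projective covers. Both follow from the descending chain condition
    on the base ring ([dcc_noetherian], [projective_cover_ex]). *)

Set Implicit Arguments.
Unset Strict Implicit.
Unset Printing Implicit Defensive.

Import GRing.Theory.
Local Open Scope ring_scope.
Local Open Scope quotient_scope.

(** * Linear maps, submodules, quotients and free modules *)

Lemma linear_map_ex (S : pzRingType) (X Y : lmodType S) (f : X -> Y) :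
  linear f -> exists g : {linear X -> Y}, g =1 f.
Proof.
move=> fL; pose m := GRing.isLinear.Build S X Y *:%R f fL.
pose g : {linear X -> Y} := HB.pack f m.
by exists g.
Qed.

Lemma linear_injP (S : pzRingType) (X Y : lmodType S) (f : {linear X -> Y}) :
  (forall x, f x = 0 -> x = 0) -> injective f.
Proof.
by move=> f0 x y /eqP; rewrite -subr_eq0 -linearB => /eqP/f0/eqP; rewrite subr_eq0 => /eqP.
Qed.

(** Submodules are [Prop]-valued predicates, so that sums, images and preimages of
    submodules are formed without any decidability. *)
Definition submodule (S : pzRingType) (V : lmodType S) (U : V -> Prop) :=
  U 0 /\ forall a x y, U x -> U y -> U (a *: x + y).

Section SubmoduleClosure.
Variables (S : pzRingType) (V : lmodType S) (U : V -> Prop).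
Hypothesis subU : submodule U.

Lemma submodule0 : U 0. Proof. by case: subU. Qed.

Lemma submoduleD x y : U x -> U y -> U (x + y).
Proof. by case: subU => _ UL Ux Uy; rewrite -[x]scale1r; apply: UL. Qed.

Lemma submoduleZ a x : U x -> U (a *: x).
Proof. by case: subU => U0 UL Ux; rewrite -[_ *: _]addr0; apply: UL. Qed.

Lemma submoduleN x : U x -> U (- x).
Proof. by rewrite -scaleN1r; apply: submoduleZ. Qed.

Lemma submoduleB x y : U x -> U y -> U (x - y).
Proof. by move=> Ux Uy; apply/submoduleD/submoduleN. Qed.

Lemma submodule_sum (I : Type) (r : seq I) (P : pred I) (F : I -> V) :
  (forall i, P i -> U (F i)) -> U (\sum_(i <- r | P i) F i).
Proof. exact: (big_ind U submodule0 submoduleD). Qed.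

End SubmoduleClosure.

Lemma submodule_ker (S : pzRingType) (V W : lmodType S) (f : {linear V -> W}) :
  submodule (fun x => f x = 0).
Proof.
by split=> [|a x y fx fy]; rewrite ?linear0 // linearP fx fy scaler0 addr0.
Qed.

Lemma submodule_im (S : pzRingType) (V W : lmodType S) (f : {linear V -> W}) :
  submodule (fun y => exists x, f x = y).
Proof.
split=> [|a _ _ [x <-] [y <-]]; first by exists 0; rewrite linear0.
by exists (a *: x + y); rewrite linearP.
Qed.

Lemma submodule_cap (S : pzRingType) (V : lmodType S) (U W : V -> Prop) :
  submodule U -> submodule W -> submodule (fun x => U x /\ W x).
Proof.
move=> [U0 UL] [W0 WL]; split=> // a x y [Ux Wx] [Uy Wy].
by split; [apply: UL | apply: WL].
Qed.

Section SubmoduleType.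
Variables (S : pzRingType) (V : lmodType S) (U : V -> Prop).
Hypothesis subU : submodule U.

(** The argument of type [submodule U] is a phantom: it lets the closure instance
    below be found from the predicate alone. *)
Definition submodule_pred of submodule U : {pred V} := fun x => `[< U x >].

Local Notation pU := (submodule_pred subU).

Lemma submodule_pred_closed : submod_closed pU.
Proof.
case: subU => U0 UL; split; first exact/asboolP.
by move=> a x y /asboolP Ux /asboolP Uy; apply/asboolP/UL.
Qed.

HB.instance Definition _ :=
  GRing.isSubmodClosed.Build S V pU submodule_pred_closed.

Definition submodule_type := {x : V | pU x}.

HB.instance Definition _ := Choice.on submodule_type.
HB.instance Definition _ := SubType.on submodule_type.
HB.instance Definition _ := [SubChoice_isSubLmodule of submodule_type by <:].

Definition submodule_incl : {linear submodule_type -> V} := val.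

Lemma submodule_incl_inj : injective submodule_incl.
Proof. exact: val_inj. Qed.

Lemma submodule_inclP w : U (submodule_incl w).
Proof. exact/asboolP/(valP w). Qed.

Lemma submodule_incl_ex x : U x -> exists w, submodule_incl w = x.
Proof. by move=> /asboolP Ux; exists (exist _ x Ux). Qed.

Definition quotient_type := Quotient.quot pU.

HB.instance Definition _ := GRing.Zmodule.on quotient_type.
HB.instance Definition _ := EqQuotient.on quotient_type.

Local Notation pi := (\pi_quotient_type).

Lemma quotient_projE x y : pi x = pi y <-> U (x - y).
Proof.
have piE : ((x - y) \in pU) = (pi x == pi y) := Quotient.idealrBE pU x y.
split=> [/eqP|Uxy]; first by rewrite -piE => /asboolP.
by apply/eqP; rewrite -piE; apply/asboolP.
Qed.

Lemma quotient_projD x y : pi (x + y) = pi x + pi y.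
Proof. exact: (Quotient.pi_add pU). Qed.

Definition quotient_scale a (q : quotient_type) : quotient_type := pi (a *: repr q).

Lemma quotient_projZ a x : pi (a *: x) = quotient_scale a (pi x).
Proof.
apply/quotient_projE; rewrite -scalerBr; apply: (submoduleZ subU).
by apply/quotient_projE; rewrite reprK.
Qed.

Fact quotient_scaleA a b q :
  quotient_scale a (quotient_scale b q) = quotient_scale (a * b) q.
Proof.
rewrite -[q]reprK -(quotient_projZ b) -(quotient_projZ a) -(quotient_projZ (a * b)).
by rewrite scalerA.
Qed.

Fact quotient_scale1 : left_id 1 quotient_scale.
Proof. by move=> q; rewrite -[q]reprK -quotient_projZ scale1r. Qed.

Fact quotient_scaleDr : right_distributive quotient_scale +%R.
Proof.
move=> a q r; rewrite -[q]reprK -[r]reprK -quotient_projD -!quotient_projZ.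
by rewrite scalerDr quotient_projD.
Qed.

Fact quotient_scaleDl q : {morph quotient_scale^~ q : a b / a + b}.
Proof.
by move=> a b; rewrite -[q]reprK -!quotient_projZ scalerDl quotient_projD.
Qed.

HB.instance Definition _ := GRing.Zmodule_isLmodule.Build S quotient_type
  quotient_scaleA quotient_scale1 quotient_scaleDr quotient_scaleDl.

Lemma quotient_ex : exists (Q : lmodType S) (p : {linear V -> Q}),
  Defs.surjective p /\ forall x, p x = 0 <-> U x.
Proof.
have [|p pE] := @linear_map_ex S V quotient_type pi.
  by move=> a x y; rewrite quotient_projD quotient_projZ.
exists quotient_type, p; split=> [q|x]; first by exists (repr q); rewrite pE reprK.
by rewrite -(linear0 p) !pE quotient_projE subr0.
Qed.

End SubmoduleType.

Lemma kernel_ex (S : pzRingType) (X Y : lmodType S) (f : {linear X -> Y}) :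
  exists (K : lmodType S) (i : {linear K -> X}), injective i /\ exact i f.
Proof.
have sK := submodule_ker f.
exists (submodule_type sK), (submodule_incl sK); split.
  exact: submodule_incl_inj.
move=> y; split=> [/(submodule_incl_ex sK)//|[w <-]].
exact: (submodule_inclP w).
Qed.

Lemma image_ex (S : pzRingType) (X Y : lmodType S) (f : {linear X -> Y}) :
  exists (W : lmodType S) (e : {linear X -> W}) (i : {linear W -> Y}),
  [/\ Defs.surjective e, injective i & forall x, i (e x) = f x].
Proof.
have sW := submodule_im f; have inj_i := @submodule_incl_inj _ _ _ sW.
have/choice[e eE] x := submodule_incl_ex sW (ex_intro _ x (erefl (f x))).
have [|g gE] := @linear_map_ex _ X (submodule_type sW) e.
  by move=> a x y; apply: inj_i; rewrite [RHS]linearP !eE linearP.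
exists (submodule_type sW), g, (submodule_incl sW); split=> // [w|x].
  have [x fx] := submodule_inclP w.
  by exists x; apply: inj_i; rewrite gE eE.
by rewrite gE eE.
Qed.

(** The universal property of a cokernel, with linearity checked through arbitrary
    preimages. *)
Lemma descend_along (S : pzRingType) (X Y Z : lmodType S)
    (p : {linear X -> Y}) (h : {linear X -> Z}) :
  Defs.surjective p -> (forall x, p x = 0 -> h x = 0) ->
  exists g : {linear Y -> Z}, forall x, g (p x) = h x.
Proof.
move=> /choice[s sK] ph.
have hs x y : p x = p y -> h x = h y.
  move=> pxy; apply/eqP; rewrite -subr_eq0 -linearB; apply/eqP/ph.
  by rewrite linearB pxy subrr.
have [|g gE] := @linear_map_ex _ Y Z (h \o s).
  by move=> a x y /=; rewrite -linearP; apply: hs; rewrite linearP !sK.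
by exists g => x; rewrite gE; apply: hs; rewrite sK.
Qed.

(** Injectivity in the form used below: [f] need not be injective, since [h] factors
    through the image of [f], to which the definition of injectivity applies. *)
Lemma extend_along (S : pzRingType) (E X Y : lmodType S)
    (f : {linear X -> Y}) (h : {linear X -> E}) :
  injective_module E -> (forall x, f x = 0 -> h x = 0) ->
  exists k : {linear Y -> E}, forall x, k (f x) = h x.
Proof.
move=> injE fh; have [W [e [i [e_surj i_inj ie]]]] := image_ex f.
have [|g gE] := descend_along (h := h) e_surj.
  by move=> x ex; apply: fh; rewrite -ie ex linear0.
have [k kE] := injE _ _ i g i_inj.
by exists k => x; rewrite -ie kE.
Qed.

(** Dual to [extend_along]: [f] need not be surjective, since [h] lands in its image. *)
Lemma lift_along (S : pzRingType) (P X Y : lmodType S)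
    (f : {linear X -> Y}) (h : {linear P -> Y}) :
  projective P -> (forall p, exists x, f x = h p) ->
  exists k : {linear P -> X}, forall p, f (k p) = h p.
Proof.
move=> projP fh; have [W [e [i [e_surj i_inj ie]]]] := image_ex f.
have /choice[h1 h1E] p : exists w, i w = h p.
  by have [x <-] := fh p; exists (e x).
have [|h' h'E] := @linear_map_ex _ P W h1.
  by move=> a x y; apply: i_inj; rewrite linearP !h1E linearP.
have [k kE] := projP _ _ e h' e_surj.
by exists k => p; rewrite -ie kE h'E h1E.
Qed.

Lemma free_map_ex (S : pzRingType) (V : lmodType S) m (e : 'I_m -> V) :
  exists f : {linear 'rV[S]_m -> V}, forall r, f r = \sum_(i < m) r 0 i *: e i.
Proof.
apply: linear_map_ex => a x y; rewrite scaler_sumr -big_split.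
by apply: eq_bigr => i _; rewrite !mxE scalerDl scalerA.
Qed.

Lemma projective_free (S : pzRingType) m : projective 'rV[S]_m.
Proof.
move=> X Y g h /(_ (h (delta_mx 0 _)))-/choice[e eE].
have [k kE] := free_map_ex e; exists k => r.
rewrite kE linear_sum [r in RHS]row_sum_delta linear_sum.
by apply: eq_bigr => i _; rewrite !linearZ eE.
Qed.

Lemma finitely_generated_free (S : pzRingType) m : finitely_generated 'rV[S]_m.
Proof.
by exists m, (fun i => delta_mx 0 i) => r; exists (fun i => r 0 i); apply: row_sum_delta.
Qed.

Lemma free_cover_ex (S : pzRingType) (M : lmodType S) : finitely_generated M ->
  exists m (f : {linear 'rV[S]_m -> M}), Defs.surjective f.
Proof.
move=> [m [e eE]]; have [f fE] := free_map_ex e; exists m, f => v.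
have [c ->] := eE v; exists (\row_i c i).
by rewrite fE; apply: eq_bigr => i _; rewrite mxE.
Qed.

Lemma finitely_generated_quo (S : pzRingType) (M N : lmodType S) (f : {linear M -> N}) :
  finitely_generated M -> Defs.surjective f -> finitely_generated N.
Proof.
move=> [m [e eE]] f_surj; exists m, (f \o e) => y; have [x <-] := f_surj y.
have [c ->] := eE x; exists c; rewrite linear_sum.
by apply: eq_bigr => i _; rewrite linearZ.
Qed.

Lemma inl_map_ex (S : pzRingType) (X Z : lmodType S) :
  exists j : {linear X -> (X * Z)%type}, forall x, j x = (x, 0).
Proof.
apply: linear_map_ex => a x y.
by rewrite [RHS]surjective_pairing /= scaler0 addr0.
Qed.

(** * Chain conditions on submodules *)

Lemma Prop_pred_ext (T : Type) (A B : T -> Prop) :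
  (forall x, A x <-> B x) -> A = B.
Proof. by move=> AB; apply/funext => x; apply/propext. Qed.

(** Induction on the number of generators, phrased for predicates on submodules so
    that it serves the descending chain condition and noetherianity alike: a
    property of the zero submodule that survives adding one generator holds for
    the whole module. *)
Lemma finitely_generated_ind (S : pzRingType) (V : lmodType S)
    (P : (V -> Prop) -> Prop) :
  P (fun x => x = 0) ->
  (forall (X : V -> Prop) e, submodule X -> P X ->
     P (fun v => exists a, X (v - a *: e))) ->
  finitely_generated V -> P (fun=> True).
Proof.
move=> P0 PS [m [e eE]].
have -> : (fun=> True) =
    (fun v : V => exists c : 'I_m -> S, v = \sum_(i < m) c i *: e i).
  by apply: Prop_pred_ext => v; split.
have spanS p (e' : 'I_p -> V) :
    submodule (fun v : V => exists c : 'I_p -> S, v = \sum_(i < p) c i *: e' i).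
  split=> [|a _ _ [c ->] [d ->]].
    by exists (fun=> 0); rewrite big1 // => i _; rewrite scale0r.
  exists (fun i => a * c i + d i); rewrite scaler_sumr -big_split.
  by apply: eq_bigr => i _; rewrite scalerDl scalerA.
elim: m e {eE} => [|m IHm] e.
  congr (P _): P0; apply: Prop_pred_ext => v; split=> [->|[c ->]]; last by rewrite big_ord0.
  by exists (fun=> 0); rewrite big_ord0.
have := PS _ (e ord_max) (spanS m _) (IHm (fun i => e (widen_ord (leqnSn m) i))).
congr (P _); apply: Prop_pred_ext => v; split=> [[a [c cE]]|[c ->]].
  exists (fun i => oapp c a (unlift ord_max i)).
  rewrite big_ord_recr /= unlift_none -[LHS](subrK (a *: e ord_max)) cE.
  congr (_ + _); apply: eq_bigr => i _; congr (_ *: _).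
  by rewrite (_ : widen_ord _ i = lift ord_max i) ?liftK //; apply/val_inj/esym/lift_max.
exists (c ord_max), (fun i => c (widen_ord (leqnSn m) i)).
by rewrite big_ord_recr addrK.
Qed.

(** Both chain conditions are relativized to a submodule [W] of a fixed module, which
    is what makes [finitely_generated_ind] applicable without changing modules. *)
Definition dcc_below (S : pzRingType) (V : lmodType S) (W : V -> Prop) :=
  forall N : nat -> V -> Prop, (forall k, submodule (N k)) ->
    (forall k x, N k.+1 x -> N k x) -> (forall x, N 0 x -> W x) ->
    exists m, forall k, (m <= k)%N -> forall x, N m x -> N k x.

Definition dcc (S : pzRingType) (V : lmodType S) := dcc_below (fun _ : V => True).

Definition fg_submodule (S : pzRingType) (V : lmodType S) (U : V -> Prop) :=
  exists m (e : 'I_m -> V), (forall i, U (e i)) /\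
    forall v, U v -> exists c : 'I_m -> S, v = \sum_(i < m) c i *: e i.

Definition noetherian_below (S : pzRingType) (V : lmodType S) (W : V -> Prop) :=
  forall U : V -> Prop, submodule U -> (forall x, U x -> W x) -> fg_submodule U.

Definition noetherian (S : pzRingType) (V : lmodType S) :=
  noetherian_below (fun _ : V => True).

Lemma decreasing_le (T : Type) (N : nat -> T -> Prop) :
  (forall k x, N k.+1 x -> N k x) ->
  forall m k, (m <= k)%N -> forall x, N k x -> N m x.
Proof.
move=> Nd m; elim=> [|k IHk]; first by rewrite leqn0 => /eqP->.
by rewrite leq_eqVlt ltnS => /predU1P[->//|/IHk Nkm x /Nd/Nkm].
Qed.

(** Nested submodules [N' <= N] of [X + S e] are equal as soon as they meet [X] in the
    same submodule and define the same ideal of coefficients [a], those with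
    [x + a *: e] in the submodule for some [x] in [X]. Along a decreasing chain both
    stabilize, hence so does the chain. *)
Lemma dcc_below_add (S : pzRingType) (V : lmodType S) (X : V -> Prop) (e : V) :
  dcc S^o -> submodule X -> dcc_below X ->
  dcc_below (fun v => exists a, X (v - a *: e)).
Proof.
move=> dccS sX dccX N sN Nd N0.
have [//||//|m1 Hm1] := dccX (fun k x => N k x /\ X x).
- by move=> k; apply: submodule_cap.
- by move=> k x [/Nd].
- by move=> x [].
have [//|||m2 Hm2] := dccS (fun k (a : S^o) => exists2 x, X x & N k (x + (a : S) *: e)).
- move=> k; split=> [|a b c [x Xx Nx] [y Xy Ny]].
    by exists 0; rewrite ?scale0r ?addr0; apply: submodule0.
  exists (a *: x + y); first exact: sX.2.
  rewrite -[_ *: b + c]/((a * b + c)%R : S) scalerDl -scalerA addrACA -scalerDr.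
  exact: (sN k).2.
- by move=> k a [x Xx /Nd]; exists x.
- by [].
exists (maxn m1 m2) => k; rewrite geq_max => /andP[km1 km2] x Nx.
have Nle := decreasing_le Nd.
have [a Xxa] := N0 x (Nle _ _ (leq0n _) _ Nx).
have [|y Xy Ny] := Hm2 k km2 a.
  by exists (x - a *: e) => //; rewrite subrK; apply: Nle Nx; apply: leq_maxr.
have [|Nxy _] := Hm1 k km1 (x - (y + a *: e)).
  split; last by rewrite opprD addrCA addrC; apply: submoduleB.
  apply: submoduleB => //; first by apply: Nle Nx; apply: leq_maxl.
  exact: Nle Ny.
by rewrite -[x](subrK (y + a *: e)); apply: submoduleD.
Qed.

Lemma dcc_finitely_generated (S : pzRingType) (V : lmodType S) :
  dcc S^o -> finitely_generated V -> dcc V.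
Proof.
move=> dccS; apply: (@finitely_generated_ind _ _ (@dcc_below S V)).
  move=> N sN Nd N0; exists 0%N => k _ x /N0->; exact: submodule0.
by move=> X e; apply: dcc_below_add.
Qed.

Lemma fg_submodule_ext (S : pzRingType) (V : lmodType S) (U W : V -> Prop)
    m (e : 'I_m -> V) :
  (forall i, U (e i)) -> (forall x, W x -> U x) -> fg_submodule W ->
  (forall u, U u -> exists c : 'I_m -> S, W (u - \sum_(i < m) c i *: e i)) ->
  fg_submodule U.
Proof.
move=> Ue WU [p [f [Wf fE]]] eE.
exists (m + p)%N, (fun i => match split i with inl j => e j | inr j => f j end).
split=> [i|u Uu]; first by case: split => j //; apply/WU/Wf.
have [c /fE[d dE]] := eE u Uu.
exists (fun i => match split i with inl j => c j | inr j => d j end).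
rewrite big_split_ord /= -[LHS](subrK (\sum_(i < m) c i *: e i)) dE addrC.
congr (_ + _); apply: eq_bigr => i _;
  by rewrite (unsplitK (inl _)) || rewrite (unsplitK (inr _)).
Qed.

(** Same invariants as in [dcc_below_add]: lift generators of the ideal of
    coefficients along [e], and add generators of the part lying in [X]. *)
Lemma noetherian_below_add (S : pzRingType) (V : lmodType S) (X : V -> Prop) (e : V) :
  noetherian S^o -> submodule X -> noetherian_below X ->
  noetherian_below (fun v => exists a, X (v - a *: e)).
Proof.
move=> noS sX noX U sU UX.
have [||m [r [rJ rE]]] := noS (fun a : S^o => exists2 x, X x & U (x + (a : S) *: e)).
- split=> [|a b c [x Xx Nx] [y Xy Ny]].
    by exists 0; rewrite ?scale0r ?addr0; apply: submodule0.
  exists (a *: x + y); first exact: sX.2.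
  rewrite -[_ *: b + c]/((a * b + c)%R : S) scalerDl -scalerA addrACA -scalerDr.
  exact: sU.2.
- by [].
have /choice[x xE] i : exists x, X x /\ U (x + (r i : S) *: e).
  by have [x] := rJ i; exists x.
have Ue i := (xE i).2.
apply: (fg_submodule_ext Ue (W := fun v => U v /\ X v)) => [v []//||u Uu].
  by apply: noX => [|v []//]; apply: submodule_cap.
have [a Xa] := UX u Uu.
have [|c cE] := rE a; first by exists (u - a *: e) => //; rewrite subrK.
exists c; split.
  by apply: submoduleB => //; apply: submodule_sum => // i _; apply: submoduleZ.
rewrite (_ : _ - _ = u - a *: e - \sum_i c i *: x i).
  apply: submoduleB => //; apply: submodule_sum => // i _; apply: submoduleZ => //.
  exact: (xE i).1.
rewrite cE scaler_suml -addrA -opprD -big_split; congr (_ - _).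
by apply: eq_bigr => i _; rewrite scalerDr addrC scalerA.
Qed.

Lemma noetherian_finitely_generated (S : pzRingType) (V : lmodType S) :
  noetherian S^o -> finitely_generated V -> noetherian V.
Proof.
move=> noS; apply: (@finitely_generated_ind _ _ (@noetherian_below S V)).
  move=> U sU U0; exists 0%N, (fun=> 0); split=> [i|v /U0->]; first exact: submodule0.
  by exists (fun=> 0); rewrite big_ord0.
by move=> X e; apply: noetherian_below_add.
Qed.

(** A nonempty family without a minimal member would contain, by iterated choice, an
    infinite strictly decreasing sequence. *)
Lemma dcc_minimal (S : pzRingType) (V : lmodType S) (P : (V -> Prop) -> Prop) U0 :
  dcc V -> submodule U0 -> P U0 ->
  exists U, [/\ submodule U, P U & forall W, submodule W -> P W ->
    (forall x, W x -> U x) -> forall x, U x -> W x].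
Proof.
move=> dccV sU0 PU0; apply: contrapT => noMin.
pose Q U := submodule U /\ P U.
have /choice[s sE] (U : {U : V -> Prop | Q U}) : exists W : {U : V -> Prop | Q U},
    (forall x, sval W x -> sval U x) /\ ~ (forall x, sval U x -> sval W x).
  case: U => U [sU PU] /=; apply: contrapT => noW; apply: noMin; exists U.
  split=> // W sW PW WU; apply: contrapT => UW.
  by apply: noW; exists (exist _ W (conj sW PW)).
pose N k := iter k s (exist _ U0 (conj sU0 PU0)).
have [//|||m] := dccV (fun k => sval (N k)); first by move=> k; case: (N k) => U [].
  by move=> k; apply: (sE (N k)).1.
  by [].
by move=> /(_ m.+1 (leqnSn m)); apply: (sE (N m)).2.
Qed.

(** * Artin algebras are artinian and noetherian on both sides *)

Section ConsecutiveSpans.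
Variables (S : pzRingType) (V : lmodType S) (x : nat -> V).

Definition consecutive_span k m (v : V) :=
  exists c : nat -> S, v = \sum_(k <= j < m) c j *: x j.

Lemma submodule_consecutive_span k m : submodule (consecutive_span k m).
Proof.
split=> [|a _ _ [c ->] [d ->]].
  by exists (fun=> 0); rewrite big1 // => j _; rewrite scale0r.
exists (fun j => a * c j + d j); rewrite scaler_sumr -big_split.
by apply: eq_bigr => j _; rewrite scalerDl scalerA.
Qed.

Lemma consecutive_span_widen k m p q v : (p <= k)%N -> (m <= q)%N ->
  consecutive_span k m v -> consecutive_span p q v.
Proof.
move=> pk mq [c ->]; have sC := submodule_consecutive_span p q.
rewrite big_nat; apply: submodule_sum => // j /andP[kj jm].
apply: submoduleZ => //; exists (fun i => (i == j)%:R).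
rewrite (bigD1_seq j) ?iota_uniq ?mem_index_iota ?(leq_trans pk kj) ?(leq_trans jm mq) //=.
by rewrite eqxx mulr1n scale1r big1 ?addr0 // => i /negPf->; rewrite mulr0n scale0r.
Qed.

Lemma consecutive_span_gen k m : (k < m)%N -> consecutive_span k m (x k).
Proof.
move=> km; apply: (@consecutive_span_widen k k.+1) => //.
by exists (fun=> 1); rewrite big_nat1 scale1r.
Qed.

Definition tail_span k v := exists m, consecutive_span k m v.

Lemma submodule_tail_span k : submodule (tail_span k).
Proof.
split=> [|a u v [m Hu] [p Hv]].
  by exists 0%N; exact: (submodule0 (submodule_consecutive_span _ _)).
exists (maxn m p); apply: (submodule_consecutive_span _ _).2.
  by apply: consecutive_span_widen Hu => //; apply: leq_maxl.
by apply: consecutive_span_widen Hv => //; apply: leq_maxr.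
Qed.

End ConsecutiveSpans.

(** Not being finitely generated allows choosing, again and again, an element outside
    the span of the previous choices. *)
Lemma independent_sequence_ex (S : pzRingType) (V : lmodType S) (U : V -> Prop) :
  ~ fg_submodule U -> exists x : nat -> V,
  (forall k, U (x k)) /\ forall k, ~ consecutive_span x 0 k (x k).
Proof.
move=> nfgU.
(* [F] picks an element outside the span of a list; [l] iterates it, and [x k] is
   the k-th choice. *)
have /choice[F FE] (l : seq V) : exists y, (forall j, (j < size l)%N -> U (l`_j)) ->
    U y /\ ~ consecutive_span (nth 0 l) 0 (size l) y.
  have [Ul|] := pselect (forall j, (j < size l)%N -> U (l`_j)); last by exists 0.
  apply: contrapT => noy; apply: nfgU.
  exists (size l), (fun i => l`_i); split=> [i|v Uv]; first exact: Ul.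
  apply: contrapT => vl; apply: noy; exists v => _; split=> // -[c cE].
  by apply: vl; exists (fun i => c i); rewrite cE big_mkord.
pose l := fix l k := if k is j.+1 then rcons (l j) (F (l j)) else [::].
pose x k := F (l k).
have lE k : l k = mkseq x k by elim: k => //= k IHk; rewrite /x mkseqS IHk -?IHk.
have szl k : size (l k) = k by rewrite lE size_mkseq.
have nthl k j : (j < k)%N -> (l k)`_j = x j by move=> jk; rewrite lE nth_mkseq.
have Ux k : U (x k).
  elim/ltn_ind: k => k IHk; apply: (FE (l k) _).1 => j.
  by rewrite szl => jk; rewrite nthl //; apply: IHk.
exists x; split=> // k [c cE]; apply: (FE (l k) _).2 => [j|].
  by rewrite szl => jk; rewrite nthl.
rewrite szl; exists c; rewrite -/(x k) cE !big_mkord.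
by apply: eq_bigr => j _; rewrite nthl.
Qed.

(** The ideals of the [a] that act on [U] as multiples of [r ^+ k] decrease; where
    they stabilize, [r ^+ m] acts as [r ^+ m.+1 * b], and [r] being onto on [U]
    one may cancel [r ^+ m], so that [b] inverts [r] on [U]. *)
Lemma dcc_surjective_scalar_inv (R : comPzRingType) (V : lmodType R) (U : V -> Prop) (r : R) :
  dcc R^o -> (forall y, U y -> exists2 x, U x & r *: x = y) ->
  (forall x, U x -> U (r *: x)) ->
  exists s : R, forall y, U y -> s *: (r *: y) = y.
Proof.
move=> dccR rU Ur.
pose N k (a : R^o) := exists b : R, forall x, U x -> (a : R) *: x = (r ^+ k * b) *: x.
have [||//|m /(_ m.+1 (leqnSn m) (r ^+ m))] := dccR N.
- move=> k; split=> [|a b c [d dE] [d' d'E]].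
    by exists 0 => x _; rewrite mulr0.
  exists (a * d + d') => x Ux.
  rewrite -[_ *: b + c]/((a * b + c)%R : R) scalerDl -(scalerA a b) dE // d'E //.
  by rewrite scalerA -scalerDl mulrCA -mulrDr.
- by move=> k a [b bE]; exists (r * b) => x Ux; rewrite bE // exprSr mulrA.
case=> [|b bE]; first by exists 1 => x _; rewrite mulr1.
have rmU y : U y -> exists2 x, U x & r ^+ m *: x = y.
  elim: m y {bE} => [|m IHm] y Uy; first by exists y; rewrite ?expr0 ?scale1r.
  have [z /IHm[x Ux <-] <-] := rU y Uy; exists x => //.
  by rewrite exprS scalerA.
exists b => y /rmU[x Ux <-]; rewrite [RHS]bE // !scalerA exprS.
by congr (_ *: _); rewrite [RHS]mulrC !mulrA.
Qed.

(** Take a minimal submodule [U] among those that are not finitely generated. For each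
    scalar [r], minimality applied to the kernel and the image of [r] on [U] shows
    that [r] is zero or onto on [U]; so, by [dcc_surjective_scalar_inv], [U] is a
    vector space over [R] modulo its annihilator, of infinite dimension.
    The spans of the tails of an independent sequence then decrease forever. *)
Lemma dcc_noetherian (R : comPzRingType) (V : lmodType R) :
  dcc R^o -> dcc V -> noetherian V.
Proof.
move=> dccR dccV U0 sU0 _; apply: contrapT => nfgU0.
have [U [sU nfgU Umin]] := dcc_minimal (P := fun U => ~ fg_submodule U) dccV sU0 nfgU0.
have fgU W : submodule W -> (forall x, W x -> U x) -> ~ (forall x, U x -> W x) ->
    fg_submodule W.
  by move=> sW WU UW; apply: contrapT => nfgW; apply: UW; apply: Umin.
have dichotomy r : (forall x, U x -> r *: x = 0) \/
    forall y, U y -> exists2 x, U x & r *: x = y.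
  apply: contrapT => /not_orP[r0 rU].
  have [f fE] : exists f : {linear V -> V}, f =1 *:%R r.
    by apply: linear_map_ex => a x y; rewrite scalerDr !scalerA mulrC.
  have sK : submodule (fun x => U x /\ f x = 0).
    by apply: submodule_cap => //; apply: submodule_ker.
  have fgK : fg_submodule (fun x => U x /\ f x = 0).
    apply: fgU => // [x []//|UK]; apply: r0 => x /UK[_].
    by rewrite fE.
  have [|||m [e [eE eG]]] := fgU (fun y => exists2 x, U x & f x = y).
  - split=> [|a _ _ [x Ux <-] [y Uy <-]].
      by exists 0; rewrite ?linear0 //; apply: submodule0.
    by exists (a *: x + y); rewrite ?linearP //; apply: sU.2.
  - by move=> _ [x Ux <-]; rewrite fE; apply: submoduleZ.
  - by move=> UrU; apply: rU => y /UrU[x Ux <-]; exists x.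
  have /choice[g gE] i : exists x, U x /\ f x = e i.
    by have [x Ux xE] := eE i; exists x.
  apply: nfgU; apply: (fg_submodule_ext (fun i => (gE i).1) _ fgK) => [x []//|u Uu].
  have [|c cE] := eG (f u); first by exists u.
  exists c; split.
    apply: submoduleB => //; apply: submodule_sum => // i _.
    by apply: submoduleZ => //; apply: (gE i).1.
  rewrite linearB linear_sum cE; apply/eqP; rewrite subr_eq0; apply/eqP.
  by apply: eq_bigr => i _; rewrite linearZ (gE i).2.
(* The chain of tails is constant from [k] on, so [x k] is a combination of later
   terms; the last term with a nonzero coefficient is a combination of the others. *)
have [x [Ux xI]] := independent_sequence_ex nfgU.
have [||//|k Hk] := dccV (tail_span x).
- exact: submodule_tail_span.
- by move=> k v [m Hv]; exists m; apply: consecutive_span_widen Hv.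
have [|m] := Hk k.+1 (leqnSn k) (x k).
  by exists k.+1; apply: consecutive_span_gen.
elim: m => [|m IHm] [c cE].
  apply: (xI k); rewrite cE big_geq //.
  exact: (submodule0 (submodule_consecutive_span _ _ _)).
have [mk|km] := leqP m k.
  apply: (xI k); rewrite cE big_geq //.
  exact: (submodule0 (submodule_consecutive_span _ _ _)).
move: cE; rewrite big_nat_recr //= => cE.
have sX := submodule_consecutive_span x 0 m.
have [cm0|cmU] := dichotomy (c m).
  by apply: IHm; exists c; rewrite cE cm0 // addr0.
have [|s sE] := dcc_surjective_scalar_inv dccR cmU; first by move=> y; apply: submoduleZ.
apply: (xI m); rewrite -[x m]sE // (_ : c m *: x m = x k - \sum_(k.+1 <= i < m) c i *: x i).
  apply: submoduleZ => //; apply: submoduleB => //.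
    apply: (@consecutive_span_widen _ _ _ k k.+1) => //.
    exact: consecutive_span_gen.
  by apply: (@consecutive_span_widen _ _ _ k.+1 m) => //; exists c.
by rewrite [x k]cE addrAC subrr add0r.
Qed.

(** Chain conditions over [R] pass to a ring [S] through which [R] acts: every
    [S]-submodule is an [R]-submodule. *)
Lemma dcc_semilinear (R S : pzRingType) (V : lmodType R) (W : lmodType S)
    (phi : R -> S) (f : V -> W) :
  {morph f : x y / x + y} -> (forall a x, f (a *: x) = phi a *: f x) -> f 0 = 0 ->
  Defs.surjective f -> dcc V -> dcc W.
Proof.
move=> fD fZ f0 f_surj dccV N sN Nd _.
have [||//|m Hm] := dccV (fun k x => N k (f x)).
- move=> k; split=> [|a x y Nx Ny]; first by rewrite f0; apply: submodule0.
  by rewrite fD fZ; apply: (sN k).2.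
- by move=> k x /Nd.
by exists m => k mk y; have [x <-] := f_surj y; apply: Hm.
Qed.

Lemma noetherian_semilinear (R S : pzRingType) (V : lmodType R) (W : lmodType S)
    (phi : R -> S) (f : V -> W) :
  {morph f : x y / x + y} -> (forall a x, f (a *: x) = phi a *: f x) -> f 0 = 0 ->
  Defs.surjective f -> noetherian V -> noetherian W.
Proof.
move=> fD fZ f0 f_surj noV U sU _.
have [||m [e [Ue eE]]] := noV (fun x => U (f x)).
- split=> [|a x y Nx Ny]; first by rewrite f0; apply: submodule0.
  by rewrite fD fZ; apply: sU.2.
- by [].
exists m, (fun i => f (e i)); split=> // y; have [x <-] := f_surj y.
move=> /eE[c ->]; exists (fun i => phi (c i)).
rewrite (big_morph f fD f0); apply: eq_bigr => i _; exact: fZ.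
Qed.

Lemma artinian_dcc (R : comPzRingType) : artinian R -> dcc R^o.
Proof.
move=> artR N sN Nd _.
have [k||m Hm] := artR (fun k => submodule_pred (sN k)).
- exact: submodule_pred_closed.
- by move=> k x /asboolP/Nd Nx; apply/asboolP.
exists m => k /Hm Nk x Nx; have : x \in submodule_pred (sN k).
  by rewrite Nk; apply/asboolP.
by move/asboolP.
Qed.

(** Left and right ideals of [A] are submodules over the base ring, because its scalars
    act through the central elements [a *: 1]. *)
Lemma artin_algebra_chain (R : comPzRingType) (A : algType R) : artin_algebra A ->
  [/\ dcc A^o, noetherian A^o, dcc (A^c)^o & noetherian (A^c)^o].
Proof.
move=> [/artinian_dcc dccR fgA].
have dccA : dcc A by apply: dcc_finitely_generated.
have noA : noetherian A by apply: dcc_noetherian.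
have leftZ (a : R) (x : A^o) : a *: (x : A) = (a *: (1 : A)) *: x.
  by rewrite -[RHS]/((a *: 1 * (x : A))) -scalerAl mul1r.
have rightZ (a : R) (x : (A^c)^o) : a *: (x : A) = ((a *: (1 : A)) : A^c) *: x.
  by rewrite -[RHS]/(((x : A) * (a *: (1 : A)))) -scalerAr mulr1.
have id_surj (T : Type) : Defs.surjective (@id T) by move=> y; exists y.
split.
- exact: (@dcc_semilinear R A A A^o _ id _ leftZ).
- exact: (@noetherian_semilinear R A A A^o _ id _ leftZ).
- exact: (@dcc_semilinear R A^c A (A^c)^o _ id _ rightZ).
- exact: (@noetherian_semilinear R A^c A (A^c)^o _ id _ rightZ).
Qed.

(** * Projective covers and stable uniqueness of syzygies *)

Lemma projective_retract (S : pzRingType) (P F : lmodType S)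
    (i : {linear P -> F}) (k : {linear F -> P}) :
  projective F -> (forall p, k (i p) = p) -> projective P.
Proof.
move=> projF ki X Y g h g_surj; have [l lE] := projF X Y g (h \o k) g_surj.
by exists (l \o i) => p /=; rewrite lE /= ki.
Qed.

(** Cover [M] by a free module [F] with
    kernel [K]; let [P] be minimal with [P + K = F], and [L] minimal inside [K] with
    [P + L = F]. As [F] is projective, it has an endomorphism [g] with [g] in [P] and
    [1 - g] in [L]. Minimality of [L] and [P] forces [L = ker g] and
    [P = ker (1 - g)], so [P] is a direct summand of [F]. Minimality of [P] is
    precisely the superfluity of the kernel of [P -> M]. *)
Lemma projective_cover_ex (S : pzRingType) (M : lmodType S) :
  dcc S^o -> finitely_generated M ->
  exists (P : lmodType S) (f : {linear P -> M}), projective_cover f.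
Proof.
move=> dccS /free_cover_ex[m [f f_surj]].
have projF := @projective_free S m; have fgF := finitely_generated_free S m.
have dccF := dcc_finitely_generated dccS fgF; set F := 'rV[S]_m in f f_surj projF fgF dccF.
have sT : submodule (fun _ : F => True) by [].
have [|P [sP Pf Pmin]] :=
    dcc_minimal (P := fun U => forall x, exists2 u, U u & f (x - u) = 0) dccF sT.
  by move=> x; exists x; rewrite // subrr linear0.
have sK := submodule_ker f.
have [|L [sL [LK PL] Lmin]] := dcc_minimal (P := fun W =>
    (forall x, W x -> f x = 0) /\ forall x, exists2 u, P u & W (x - u)) dccF sK.
  by split.
have [Q [q [q_surj qE]]] := quotient_ex sL.
have [T [i [i_inj iP iex]]] : exists (T : lmodType S) (i : {linear T -> F}),
    [/\ injective i, forall w, P (i w) & forall x, P x -> exists w, i w = x].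
  exists (submodule_type sP), (submodule_incl sP); split.
  - exact: submodule_incl_inj.
  - exact: submodule_inclP.
  - exact: submodule_incl_ex.
(* Lifting the projection modulo [L] through [P] yields [g := i \o k]. *)
have [|k kE] := lift_along (P := F) (f := q \o i) (h := q) projF.
  move=> x; have [u Pu Lxu] := PL x; have [w wE] := iex u Pu.
  exists w; rewrite /= wE; apply/esym/eqP; rewrite -subr_eq0 -linearB.
  by apply/eqP/qE.
pose g : {linear F -> F} := i \o k.
have gP x : P (g x) by apply: iP.
have gL x : L (x - g x).
  by apply/qE; rewrite linearB -(kE x) subrr.
have gimP x : P x -> exists2 p, P p & g p = x.
  apply: (Pmin (fun x => exists2 p, P p & g p = x)).
  - split=> [|a _ _ [p Pp <-] [r Pr <-]].
      by exists 0; rewrite ?linear0 //; apply: submodule0.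
    by exists (a *: p + r); rewrite ?linearP //; apply: sP.2.
  - move=> y; have [u Pu fyu] := Pf y; exists (g u); first by exists u.
    by rewrite -[y](subrK u) -addrA linearD fyu add0r; apply: LK.
  - by move=> _ [p _ <-].
have gL0 x : L x -> g x = 0.
  apply: (Lmin (fun x => g x = 0)); first exact: submodule_ker.
    split=> y.
      by move=> gy; have := gL y; rewrite gy subr0 => /LK.
    have [p Pp gp] := gimP _ (gP y); exists p => //.
    by rewrite linearB gp subrr.
  by move=> y gy; have := gL y; rewrite gy subr0.
have gPid x : P x -> g x = x.
  apply: (Pmin (fun x => g x = x)).
  - split=> [|a y z gy gz]; first exact: linear0.
    by rewrite linearP gy gz.
  - move=> y; exists (g y); last exact/LK/gL.
    by apply/esym/eqP; rewrite -subr_eq0 -linearB (gL0 _ (gL y)).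
  - by move=> y <-.
have ki p : k (i p) = p.
  by apply: i_inj; rewrite [LHS]gPid.
exists T, (f \o i); split.
- by apply: (finitely_generated_quo (f := k) fgF) => p; exists (i p).
- exact: projective_retract ki.
- move=> y; have [x <-] := f_surj y; have [u Pu fxu] := Pf x.
  have [w wE] := iex u Pu; exists w; rewrite /= wE.
  by apply/esym/eqP; rewrite -subr_eq0 -linearB fxu.
move=> N [N0 NL] NE x.
suff /(_ (i x) (iP x))[y Ny /i_inj<-//] :
  forall u, P u -> exists2 y, y \in N & i y = u.
apply: Pmin => [||_ [y _ <-]]; last exact: iP.
  split=> [|a _ _ [y Ny <-] [z Nz <-]]; first by exists 0; rewrite ?linear0.
  by exists (a *: y + z); rewrite ?linearP //; apply: NL.
move=> y; have [u Pu fyu] := Pf y; have [w wE] := iex u Pu.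
have [v Nv fwv] := NE w; exists (i v); first by exists v.
rewrite -[y](subrK u) -addrA linearD fyu add0r -wE -linearB; exact: fwv.
Qed.

Lemma finitely_generated_sub (S : pzRingType) (K V : lmodType S) (i : {linear K -> V}) :
  noetherian V -> injective i -> finitely_generated K.
Proof.
move=> noV i_inj; have [//|m [e [eE eG]]] := noV _ (submodule_im i).
have /choice[d dE] := eE; exists m, d => v.
have [|c cE] := eG (i v); first by exists v.
exists c; apply: i_inj; rewrite cE linear_sum.
by apply: eq_bigr => j _; rewrite linearZ dE.
Qed.

(** A syzygy taken along any finitely generated projective presentation, not only along
    a projective cover. Covers are needed to state the delooping level, but all
    homological arguments work with this notion. *)
Definition proj_syzygy (S : pzRingType) (M K : lmodType S) :=
  exists (P : lmodType S) (f : {linear P -> M}) (i : {linear K -> P}),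
    [/\ finitely_generated P, projective P, Defs.surjective f, injective i & exact i f].

Fixpoint iter_proj_syzygy (S : pzRingType) (n : nat) (M K : lmodType S) : Prop :=
  if n is m.+1 then exists2 L, iter_proj_syzygy m M L & proj_syzygy L K else K = M.

Lemma iter_syzygy_proj (S : pzRingType) n (M K : lmodType S) :
  iter_syzygy n M K -> iter_proj_syzygy n M K.
Proof.
elim: n K => //= n IHn K [L /IHn ML [P [f [i [[fgP projP f_surj _] i_inj ex]]]]].
by exists L => //; exists P, f, i.
Qed.

Lemma finitely_generated_syzygy (S : pzRingType) (M K : lmodType S) :
  noetherian S^o -> proj_syzygy M K -> finitely_generated K.
Proof.
move=> noS [P [f [i [fgP _ _ i_inj _]]]].
exact: finitely_generated_sub (noetherian_finitely_generated noS fgP) i_inj.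
Qed.

Lemma finitely_generated_iter_syzygy (S : pzRingType) n (M K : lmodType S) :
  noetherian S^o -> finitely_generated M -> iter_proj_syzygy n M K ->
  finitely_generated K.
Proof.
move=> noS fgM; case: n => [->//|n [L _]]; exact: finitely_generated_syzygy.
Qed.

Lemma iter_syzygy_ex (S : pzRingType) n (M : lmodType S) :
  dcc S^o -> noetherian S^o -> finitely_generated M ->
  exists K, iter_syzygy n M K.
Proof.
move=> dccS noS fgM; elim: n => [|n [L ML]]; first by exists M.
have fgL := finitely_generated_iter_syzygy noS fgM (iter_syzygy_proj ML).
have [P [f fcov]] := projective_cover_ex dccS fgL.
have [K [i [i_inj ex]]] := kernel_ex f.
by exists K, L => //; exists P, f, i.
Qed.

Lemma proj_syzygy_map (S : pzRingType) (M K P M' K' P' : lmodType S)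
    (f : {linear P -> M}) (i : {linear K -> P})
    (f' : {linear P' -> M'}) (i' : {linear K' -> P'}) (phi : {linear M -> M'}) :
  projective P -> exact i f -> Defs.surjective f' -> injective i' -> exact i' f' ->
  exists (theta : {linear P -> P'}) (psi : {linear K -> K'}),
    (forall x, f' (theta x) = phi (f x)) /\ forall x, i' (psi x) = theta (i x).
Proof.
move=> projP ex f'_surj i'_inj ex'.
have [theta thetaE] := projP _ _ f' (phi \o f) f'_surj.
have /choice[psi psiE] x : exists y, i' y = theta (i x).
  apply/ex'; rewrite thetaE /= (_ : f (i x) = 0) ?linear0 //.
  by apply/ex; exists x.
have [|psi' psi'E] := @linear_map_ex _ K K' psi.
  by move=> a x y; apply: i'_inj; rewrite linearP !psiE !linearP.
by exists theta, psi'; split=> // x; rewrite psi'E.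
Qed.

(** A map of presentations that lifts the identity up to a map [v \o u] through a
    projective is, on syzygies, the identity up to a map through [P]: lift [v] to
    [v'] along [f]; then [theta - 1 - v' u f] takes its values in the syzygy. *)
Lemma proj_syzygy_null (S : pzRingType) (M K P Q : lmodType S)
    (f : {linear P -> M}) (i : {linear K -> P})
    (u : {linear M -> Q}) (v : {linear Q -> M})
    (theta : {linear P -> P}) (psi : {linear K -> K}) :
  projective P -> projective Q -> Defs.surjective f -> injective i -> exact i f ->
  (forall x, f (theta x) = f x + v (u (f x))) ->
  (forall x, i (psi x) = theta (i x)) ->
  exists s : {linear P -> K}, forall x, psi x - x = s (i x).
Proof.
move=> projP projQ f_surj i_inj ex thetaE psiE.
have [v' v'E] := projQ _ _ f v f_surj.
pose d : {linear P -> P} := theta \- idfun \- (v' \o u \o f).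
have dE x : d x = theta x - x - v' (u (f x)) by [].
have [|s sE] := lift_along (f := i) (h := d) projP.
  by move=> x; apply/ex; rewrite dE !linearB thetaE v'E [f x + _]addrC addrK subrr.
exists s => x; apply: i_inj; rewrite sE dE linearB psiE.
have fi : f (i x) = 0 by apply/ex; exists x.
by rewrite fi (linear0 u) (linear0 v') subr0.
Qed.

(** Hence the stable class of the syzygy depends only on the stable class of the
    module and not on the presentations. *)
Lemma stable_iso_syzygy (S : pzRingType) (M M' K K' : lmodType S) :
  stable_iso M M' -> proj_syzygy M K -> proj_syzygy M' K' -> stable_iso K K'.
Proof.
move=> [phi [phi' [[Q [u [v [_ projQ uvE]]]] [Q' [u' [v' [_ projQ' u'v'E]]]]]]].
move=> [P [f [i [fgP projP f_surj i_inj ex]]]].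
move=> [P' [f' [i' [fgP' projP' f'_surj i'_inj ex']]]].
have [th [psi [thE psiE]]] := proj_syzygy_map phi projP ex f'_surj i'_inj ex'.
have [th' [psi' [th'E psi'E]]] := proj_syzygy_map phi' projP' ex' f_surj i_inj ex.
exists psi, psi'; split.
  have [||s sE] := proj_syzygy_null (u := u) (v := v) (theta := th' \o th)
      (psi := psi' \o psi) projP projQ f_surj i_inj ex.
  - by move=> x; rewrite /= th'E thE -uvE /= addrC subrK.
  - by move=> x; rewrite /= psi'E psiE.
  by exists P, i, s.
have [||s sE] := proj_syzygy_null (u := u') (v := v') (theta := th \o th')
    (psi := psi \o psi') projP' projQ' f'_surj i'_inj ex'.
- by move=> x; rewrite /= thE th'E -u'v'E /= addrC subrK.
- by move=> x; rewrite /= psiE psi'E.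
by exists P', i', s.
Qed.

Lemma trivial_module_ex (S : pzRingType) :
  exists Z : lmodType S, forall z : Z, z = 0.
Proof. by exists 'rV[S]_0 => z; apply: thinmx0. Qed.

Lemma trivial_projective (S : pzRingType) (Z : lmodType S) :
  (forall z : Z, z = 0) -> projective Z /\ finitely_generated Z.
Proof.
move=> Z0; split.
  by move=> X Y g h _; exists \0 => z; rewrite (Z0 z) !linear0.
by exists 0%N, (fun=> 0) => v; exists (fun=> 0); rewrite big_ord0.
Qed.

Lemma stable_iso_refl (S : pzRingType) (M : lmodType S) : stable_iso M M.
Proof.
have [Z Z0] := trivial_module_ex S; have [projZ fgZ] := trivial_projective Z0.
by exists idfun, idfun; split; exists Z, \0, \0; split=> // x; rewrite subrr.
Qed.

Lemma stable_iso_iter_syzygy (S : pzRingType) n (M K K' : lmodType S) :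
  iter_proj_syzygy n M K -> iter_proj_syzygy n M K' -> stable_iso K K'.
Proof.
elim: n K K' => [K K' -> ->|n IHn K K' [L ML LK] [L' ML' LK']].
  exact: stable_iso_refl.
exact: stable_iso_syzygy (IHn _ _ ML ML') LK LK'.
Qed.

Lemma stable_iso_summand (S : pzRingType) (X Y : lmodType S) :
  stable_iso X Y -> stable_direct_summand X Y.
Proof.
move=> [f [g [[P [u [v [fgP projP uvE]]]] [Q [u' [v' [fgQ projQ u'v'E]]]]]]].
have [Z Z0] := trivial_module_ex S; have [_ fgZ] := trivial_projective Z0.
exists Z; split=> //.
have [inl inlE] := inl_map_ex X Z.
exists (f \o fst), (inl \o g); split.
  exists P, (u \o fst), (inl \o v); split=> // -[x z] /=.
  by rewrite !inlE -uvE [LHS]surjective_pairing [X in (_, X) = _]Z0.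
by exists Q, u', v'; split=> // y /=; rewrite inlE /= -u'v'E.
Qed.

(** * Vanishing of Ext through an injective coresolution *)

Section ExtVanishing.
Variables (S : pzRingType) (E : lmodType S) (I : nat -> lmodType S).
Variables (eps : {linear E -> I 0%N}) (d : forall i, {linear I i -> I i.+1}).

Definition injective_coresolution :=
  [/\ injective eps, exact eps (d 0%N), forall i, exact (d i) (d i.+1)
    & forall i, injective_module (I i)].

(** This says that [Ext^(i+1)(M, E) = 0], the group being computed from the
    coresolution: each cocycle on [M] in degree [i+1] is a coboundary. The index is
    shifted because degree 0 never occurs. *)
Definition ext_vanish i (M : lmodType S) :=
  forall h : {linear M -> I i.+1}, (forall x, d i.+1 (h x) = 0) ->
  exists k : {linear M -> I i}, forall x, d i (k x) = h x.

Hypothesis res : injective_coresolution.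

Let eps_inj : injective eps. Proof. by case: res. Qed.
Let ex0 : exact eps (d 0%N). Proof. by case: res. Qed.
Let exd i : exact (d i) (d i.+1). Proof. by case: res. Qed.
Let injI i : injective_module (I i). Proof. by case: res. Qed.

Lemma ext_vanish_beyond n i (M : lmodType S) :
  (forall i, (n < i)%N -> forall x : I i, x = 0) -> (n <= i)%N -> ext_vanish i M.
Proof.
by move=> I0 ni h _; exists \0 => x; rewrite [LHS]I0 // [RHS]I0.
Qed.

(** Dimension shifting, from [Ext^(i+2)(M, E)] to [Ext^(i+1)(K, E)]: extend the cocycle
    from [K] to [P], where its differential factors through [M] and is a coboundary
    there; correct the extension accordingly and lift it, [P] being projective. *)
Lemma ext_vanish_syzygy i (M K : lmodType S) :
  proj_syzygy M K -> ext_vanish i.+1 M -> ext_vanish i K.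
Proof.
move=> [P [f [j [_ projP f_surj j_inj ex]]]] extM h dh.
have fj x : f (j x) = 0 by apply/ex; exists x.
have [x jx0|h' h'E] := extend_along (f := j) (h := h) (@injI _).
  by rewrite (j_inj x 0) ?linear0.
have [x /ex[y <-]|g gE] := descend_along (h := d i.+1 \o h') f_surj.
  by rewrite /= h'E.
have [y|k kE] := extM g.
  by have [x <-] := f_surj y; rewrite gE; apply/exd; exists (h' x).
have [x|l lE] := lift_along (f := d i) (h := h' \- (k \o f)) projP.
  by apply/exd; rewrite linearB [X in _ - X]kE gE subrr.
by exists (l \o j) => x; rewrite [LHS]lE /= fj linear0 subr0.
Qed.

(** The bottom case of dimension shifting, where [E], the kernel of [d 0], takes the
    place of the preceding term of the coresolution. *)
Lemma ext_vanish_extend (M K P : lmodType S)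
    (f : {linear P -> M}) (j : {linear K -> P}) (h : {linear K -> E}) :
  projective P -> Defs.surjective f -> injective j -> exact j f ->
  ext_vanish 0 M -> exists k : {linear P -> E}, forall x, k (j x) = h x.
Proof.
move=> projP f_surj j_inj ex extM.
have fj x : f (j x) = 0 by apply/ex; exists x.
have [x jx0|h' h'E] := extend_along (f := j) (h := eps \o h) (@injI _).
  by rewrite (j_inj x 0) ?linear0.
have [x /ex[y <-]|g gE] := descend_along (h := d 0 \o h') f_surj.
  by rewrite /= h'E; apply/ex0; exists (h y).
have [y|k kE] := extM g.
  by have [x <-] := f_surj y; rewrite gE; apply/exd; exists (h' x).
have [x|l lE] := lift_along (f := eps) (h := h' \- (k \o f)) projP.
  by apply/ex0; rewrite linearB [X in _ - X]kE gE subrr.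
by exists l => x; apply: eps_inj; rewrite lE /= fj linear0 subr0.
Qed.

Lemma ext_vanish_cosyzygy i (M K : lmodType S) :
  proj_syzygy M K -> ext_vanish i K -> ext_vanish i.+1 M.
Proof.
move=> [P [f [j [_ projP f_surj j_inj ex]]]] extK g dg.
have fj x : f (j x) = 0 by apply/ex; exists x.
have [x|l lE] := lift_along (f := d i.+1) (h := g \o f) projP.
  by apply/exd; apply: dg.
have [x|k kE] := extK (l \o j).
  by rewrite [LHS]lE /= fj linear0.
have [x jx0|k' k'E] := extend_along (f := j) (h := k) (@injI _).
  by rewrite (j_inj x 0) ?linear0.
have [x /ex[y <-]|m mE] := descend_along (h := l \- (d i \o k')) f_surj.
  by rewrite /= k'E kE subrr.
exists m => y; have [x <-] := f_surj y; rewrite mE linearB [X in X - _]lE.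
by rewrite [X in _ - X](_ : _ = 0) ?subr0 //; apply/exd; exists (k' x).
Qed.

Lemma ext_vanish_iter_syzygy n i (M K : lmodType S) :
  iter_proj_syzygy n M K -> ext_vanish (n + i) M <-> ext_vanish i K.
Proof.
elim: n i K => [i K ->//|n IHn i K [L ML LK]]; rewrite addSnnS; split.
  by move=> /(IHn _ _ ML)/(ext_vanish_syzygy LK).
by move=> /(ext_vanish_cosyzygy LK) extL; apply/(IHn _ _ ML).
Qed.

(** Ext in positive degree factors through the stable category, since cocycles on a
    projective are coboundaries. *)
Lemma ext_vanish_summand i (X Y : lmodType S) :
  stable_direct_summand X Y -> ext_vanish i Y -> ext_vanish i X.
Proof.
move=> [Z [_ [f [g [[P [u [v [_ projP uvE]]]] _]]]]] extY h dh.
have [y|k kE] := extY (h \o (fst \o g)); first exact: dh.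
have [p|l lE] := lift_along (f := d i) (h := h \o (fst \o v)) projP.
  by apply/exd; apply: dh.
have [inl inlE] := inl_map_ex X Z.
exists ((k \o (f \o inl)) \- (l \o (u \o inl))) => x.
rewrite linearB [X in X - _]kE [X in _ - X]lE /= -linearB -linearB -uvE.
by rewrite opprB addrC subrK inlE.
Qed.

End ExtVanishing.

(** * Shortening an injective coresolution *)

(** Baer's criterion. Partial extensions of [h] are encoded as their graphs in
    [Y * Z], which Zorn's lemma orders by inclusion. If a maximal graph [G] misses
    [y], the ideal of the [a] with [a *: y] in its domain maps to [Z] through [G];
    the extension of this map to [S] says where [y] may be sent. *)
Lemma baer_criterion (S : pzRingType) (Z : lmodType S) :
  (forall (J : lmodType S) (i : {linear J -> S^o}) (h : {linear J -> Z}),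
     injective i -> exists k : {linear S^o -> Z}, forall x, k (i x) = h x) ->
  injective_module Z.
Proof.
move=> baerZ X Y i h i_inj.
pose good (G : set (Y * Z)%type) := [/\ submodule G, (forall z, G (0, z) -> z = 0)
  & forall x, G (i x, h x)].
(* The empty set is admitted so that the union of the empty chain qualifies. *)
have [F Fgood totF|G [goodG maxG]] :=
    @Zorn_bigcup _ (fun G : set (Y * Z)%type => good G \/ G = set0).
  have [[G0 [FG0 goodG0]]|noG] := pselect (exists G, F G /\ good G); last first.
    right; rewrite -subset0 => yz [G FG Gyz].
    have [gG|G0] := Fgood G FG; first by case: noG; exists G.
    by move: Gyz; rewrite G0.
  have goodF G yz : F G -> G yz -> good G.
    by move=> /Fgood[//|->].
  have [sG0 G00 G0h] := goodG0; left; split=> [|z [G FG Gz]|x].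
  - split=> [|a y z [G FG Gy] [G' FG' Gz]]; first by exists G0 => //; apply: submodule0.
    have [[sG _ _] [sG' _ _]] := (goodF _ _ FG Gy, goodF _ _ FG' Gz).
    have [GG'|G'G] := totF _ _ FG FG'.
      by exists G' => //; apply: sG'.2 => //; apply: GG'.
    by exists G => //; apply: sG.2 => //; apply: G'G.
  - by have [_ + _] := goodF _ _ FG Gz; apply.
  - by exists G0.
have {}goodG : good G.
  case: goodG => // G0; exfalso.
  apply: (maxG (fun yz => exists x, yz = (i x, h x))); last first.
    left; split=> [|z [x]|x]; last by exists x.
      split=> [|a _ _ [x ->] [y ->]]; first by exists 0; rewrite !linear0.
      by exists (a *: x + y); rewrite !linearP.
    by case=> /esym ix ->; rewrite (i_inj x 0) ?linear0.
  rewrite G0; split=> // /(_ (0, 0)); apply; exists 0; by rewrite !linear0.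
have [sG G0 Gh] := goodG.
have Gfun y z z' : G (y, z) -> G (y, z') -> z = z'.
  move=> Gz Gz'; apply/eqP; rewrite -subr_eq0; apply/eqP/G0.
  have := submoduleB sG Gz Gz'; congr (G _).
  by rewrite [LHS]surjective_pairing /= subrr.
have Gtot y : exists z, G (y, z).
  apply: contrapT => noz.
  have [m mE] : exists m : {linear S^o -> Y}, forall a, m a = (a : S) *: y.
    by apply: linear_map_ex => a b c; rewrite scalerDl -scalerA.
  pose J (a : S^o) := exists z, G (m a, z).
  have sJ : submodule J.
    split=> [|a b c [z Gz] [z' Gz']].
      by exists 0; rewrite linear0; apply: (submodule0 sG).
    by exists (a *: z + z'); rewrite linearP; apply: (sG.2 _ _ _ Gz Gz').
  have /choice[g gE] (w : submodule_type sJ) : exists z, G (m (submodule_incl sJ w), z).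
    exact: submodule_inclP w.
  have [|g' g'E] := @linear_map_ex _ (submodule_type sJ) Z g.
    move=> a b c; apply: (Gfun _ _ _ (gE _)).
    by rewrite !linearP; apply: (sG.2 _ _ _ (gE b) (gE c)).
  have [k kE] := baerZ _ _ g' (@submodule_incl_inj _ _ _ sJ).
  have Gk a z : G (m a, z) -> k a = z.
    move=> Gz; have [|w wa] := submodule_incl_ex sJ (x := a); first by exists z.
    by rewrite -wa kE g'E; apply: (Gfun _ _ _ (gE w)); rewrite wa.
  pose G' (yz : Y * Z) := exists a : S^o, G (yz.1 - m a, yz.2 - k a).
  have GG' : (G `<=` G')%classic.
    by move=> [u v] Guv; exists 0; rewrite /= (linear0 m) (linear0 k) !subr0.
  apply: (maxG G').
    split=> // G'G; apply: noz; exists (k 1); apply: G'G; exists 1.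
    by rewrite mE /= scale1r !subrr; apply: (submodule0 sG).
  left; split=> [|z [a]|x]; last exact/GG'.
    split=> [|a [u v] [u' v'] [b Gb] [c Gc]].
      by exists 0; rewrite /= (linear0 m) (linear0 k) !subr0; apply: (submodule0 sG).
    exists (a *: b + c); have := sG.2 a _ _ Gb Gc; congr (G _).
    rewrite [LHS]surjective_pairing /= (linearP m) (linearP k).
    by congr (_, _); rewrite scalerBr opprD addrACA.
  rewrite /= sub0r => Gz; suff : k (- a) = z - k a.
    by rewrite linearN => /eqP; rewrite eq_sym subr_eq addNr => /eqP.
  by apply: Gk; rewrite linearN.
have /choice[k kE] := Gtot.
have [|k' k'E] := @linear_map_ex _ Y Z k.
  by move=> a y z; apply: (Gfun _ _ _ (kE _)); apply: (sG.2 _ _ _ (kE y) (kE z)).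
by exists k' => x; rewrite k'E; apply: (Gfun _ _ _ (kE _)).
Qed.

Lemma corestrict_ex (S : pzRingType) (X V : lmodType S) (U : V -> Prop)
    (sU : submodule U) (f : {linear X -> V}) : (forall x, U (f x)) ->
  exists g : {linear X -> submodule_type sU}, forall x, submodule_incl sU (g x) = f x.
Proof.
move=> Uf; have inj_i := @submodule_incl_inj _ _ _ sU.
have /choice[g gE] x := submodule_incl_ex sU (Uf x).
have [|g' g'E] := @linear_map_ex _ X (submodule_type sU) g.
  by move=> a x y; apply: inj_i; rewrite gE [RHS]linearP !gE linearP.
by exists g' => x; rewrite g'E gE.
Qed.

(** If [Ext^(n+1)(M, E) = 0] for all finitely generated [M], then the kernel of
    [d n : I n -> I n.+1] is injective: by Baer's criterion it suffices to extend maps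
    from an ideal, and the obstruction lies in [Ext^(n+1)] of the cyclic quotient.
    The coresolution may therefore be cut there. *)
Lemma injective_resolution_shorten (S : pzRingType) (E : lmodType S)
    (I : nat -> lmodType S) (eps : {linear E -> I 0%N})
    (d : forall i, {linear I i -> I i.+1}) n :
  injective_coresolution eps d ->
  (forall M : lmodType S, finitely_generated M -> ext_vanish d n M) ->
  injective_resolution E n.
Proof.
move=> [eps_inj ex0 exd injI] extn.
have dd i x : d i.+1 (d i x) = 0 by apply/exd; exists x.
(* All of [I i] for [i < n], the kernel of [d n] for [i = n], and 0 for [i > n]; one
   formula for the three cases keeps the family of modules uniform in [i]. *)
pose U i (x : I i) := ((n <= i)%N -> d i x = 0) /\ ((n < i)%N -> x = 0).
have sU i : submodule (U i).
  split=> [|a x y [x1 x2] [y1 y2]]; first by split=> // _; rewrite linear0.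
  split=> ni; first by rewrite linearP x1 // y1 // scaler0 addr0.
  by rewrite x2 // y2 // scaler0 addr0.
pose inc i := submodule_incl (sU i).
have inc_inj i : injective (inc i) by apply: submodule_incl_inj.
have incU i w : U i (inc i w) by apply: submodule_inclP.
have inc_ex i x : U i x -> exists w, inc i w = x by apply: submodule_incl_ex.
have corestr i (X : lmodType S) (f : {linear X -> I i}) : (forall x, U i (f x)) ->
    exists g : {linear X -> submodule_type (sU i)}, forall x, inc i (g x) = f x.
  exact: corestrict_ex.
have [x|eps' eps'E] := corestr 0%N _ eps.
  by split=> // _; apply/ex0; exists x.
have d'_ex i : exists d' : {linear submodule_type (sU i) -> submodule_type (sU i.+1)},
    forall w, inc i.+1 (d' w) = d i (inc i w).
  apply: (corestr i.+1 _ (d i \o inc i)) => w /=; split=> [_|]; first exact: dd.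
  by rewrite ltnS => ni; apply: (incU i w).1.
pose d' i := sval (cid (d'_ex i)).
have d'E i w : inc i.+1 (d' i w) = d i (inc i w) by apply: (svalP (cid (d'_ex i))).
have dd' i w : d' i.+1 (d' i w) = 0.
  by apply: inc_inj; rewrite !d'E dd linear0.
exists (fun i => submodule_type (sU i)), eps', d'; split.
- by move=> x y xy; apply: eps_inj; rewrite -!eps'E xy.
- move=> w; split=> [d'w|[x <-]]; last first.
    by apply: inc_inj; rewrite d'E eps'E linear0; apply/ex0; exists x.
  have /ex0[x xE] : d 0 (inc 0%N w) = 0 by rewrite -d'E d'w linear0.
  by exists x; apply: inc_inj; rewrite eps'E.
- move=> i w; split=> [d'w|[x <-]]; last exact: dd'.
  have [ni|lt_in] := leqP n i.
    exists 0; apply: inc_inj; rewrite linear0 linear0; apply/esym.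
    exact: (incU i.+1 w).2.
  have /exd[x xE] : d i.+1 (inc i.+1 w) = 0 by rewrite -d'E d'w linear0.
  have [|v vE] := inc_ex i x.
    by split=> ni; [move: lt_in; rewrite ltnNge ni | move: lt_in; rewrite ltnNge (ltnW ni)].
  by exists v; apply: inc_inj; rewrite d'E vE.
- move=> i; case: (ltngtP i n) => [lt_in|ni|i_n]; last first.
  + apply: baer_criterion => J j h j_inj.
    have [Q [q [q_surj qE]]] := quotient_ex (submodule_im j).
    have [x jx0|h' h'E] := extend_along (f := j) (h := inc i \o h) (@injI _).
      by rewrite (j_inj x 0) ?linear0.
    have [x /qE[y <-]|g gE] := descend_along (h := d i \o h') q_surj.
      by rewrite /= h'E; apply: (incU i _).1; rewrite i_n.
    have fgQ : finitely_generated Q.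
      apply: finitely_generated_quo q_surj; exists 1%N, (fun=> 1) => v.
      by exists (fun=> v); rewrite big_ord1 [RHS]mulr1.
    rewrite -i_n in extn.
    have [y|k kE] := extn Q fgQ g.
      by have [x <-] := q_surj y; rewrite gE dd.
    have [x|l lE] := corestr i _ (h' \- (k \o q)).
      split=> [_|ni]; last by rewrite i_n ltnn in ni.
      by rewrite linearB [X in _ - X]kE gE subrr.
    exists l => x; apply: inc_inj; rewrite lE /= h'E.
    have qj : q (j x) = 0 by apply/qE; exists x.
    by rewrite qj (linear0 k) subr0.
  + move=> X Y j h _; exists \0 => x; apply: inc_inj.
    by rewrite linear0; apply/esym; apply: (incU i _).2.
  + move=> X Y j h j_inj; have [k kE] := injI i _ _ j (inc i \o h) j_inj.
    have [y|l lE] := corestr i _ k.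
      by split=> ni; [move: lt_in; rewrite ltnNge ni | move: lt_in; rewrite ltnNge (ltnW ni)].
    by exists l => x; apply: inc_inj; rewrite lE kE.
- by move=> i ni w; apply: inc_inj; rewrite linear0; apply: (incU i w).2.
Qed.

(** * Matrices, presentations and duality *)

Definition row_mulmx (S : pzRingType) p q (B : 'M[S]_(p, q)) :
  {linear 'rV[S]_p -> 'rV[S]_q} := mulmxr B.

(** A matrix over [S] acts on rows, on the right, as a map of left modules, and on
    columns, on the left, as a map of right modules. So [row_exact] and [col_exact]
    speak of a complex of free modules and of its dual. *)
Definition row_exact (S : pzRingType) r p q (C : 'M[S]_(r, p)) (B : 'M[S]_(p, q)) :=
  forall z : 'rV_p, z *m B = 0 <-> exists y, y *m C = z.

Definition col_exact (S : pzRingType) r p q (C : 'M[S]_(r, p)) (B : 'M[S]_(p, q)) :=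
  forall x : 'cV_p, C *m x = 0 <-> exists y, B *m y = x.

(** Right modules being modules over the converse ring, a map of columns over [S] is a
    map of rows over [S^c], whose matrix is the transpose. *)
Definition converse_tr (S : pzRingType) p q (B : 'M[S]_(p, q)) : 'M[S^c]_(q, p) := B^T.

Lemma col_exact_tr (S : pzRingType) r p q (C : 'M[S]_(r, p)) (B : 'M[S]_(p, q)) :
  col_exact C B -> row_exact (converse_tr B) (converse_tr C).
Proof.
move=> CB z; have trE a b (X : 'M[S]_(a, b)) (y : 'rV[S^c]_b) :
    y *m converse_tr X = converse_tr (X *m converse_tr y).
  by rewrite /converse_tr trmx_mul_rev trmxK.
rewrite trE; split=> [z0|[y <-]].
  have /CB[y yE] : C *m converse_tr z = 0 by rewrite -[LHS]trmxK [X in X^T]z0 trmx0.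
  by exists (converse_tr y); rewrite trE /converse_tr trmxK yE trmxK.
rewrite trE /converse_tr trmxK; apply: (can_inj (@trmxK _ _ _)).
by rewrite trmxK trmx0; apply/CB; exists (y^T).
Qed.

(** The converse of the converse of [S] is not convertible to [S], so this is not an
    instance of [col_exact_tr]. *)
Lemma col_exact_untr (S : pzRingType) r p q (C : 'M[S]_(r, p)) (B : 'M[S]_(p, q)) :
  col_exact (converse_tr B) (converse_tr C) -> row_exact C B.
Proof.
move=> CB z; have trE a b (X : 'M[S]_(a, b)) (y : 'rV[S]_a) :
    converse_tr (y *m X) = converse_tr X *m converse_tr y.
  by rewrite /converse_tr trmx_mul_rev.
split=> [z0|[y <-]].
  have /CB[y yE] : converse_tr B *m converse_tr z = 0 by rewrite -trE z0 /converse_tr trmx0.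
  exists (y^T); apply: (can_inj (@trmxK _ _ _)); rewrite [LHS]trE -[RHS]yE.
  by rewrite /converse_tr trmxK.
apply: (can_inj (@trmxK _ _ _)); rewrite [LHS]trE trE trmx0.
by apply/CB; exists (converse_tr y).
Qed.

Lemma free_linear_form (S : pzRingType) p (f : {linear 'rV[S]_p -> S^o}) :
  exists x : 'cV_p, forall z, f z = (z *m x) 0 0.
Proof.
exists (\col_i f (delta_mx 0 i)) => z.
rewrite mxE [z in LHS]row_sum_delta linear_sum.
by apply: eq_bigr => i _; rewrite linearZ mxE.
Qed.

(** [M] is the cokernel of [B] acting on rows. *)
Definition presents (S : pzRingType) p q (B : 'M[S]_(p, q)) (M : lmodType S) :=
  exists f : {linear 'rV_q -> M}, Defs.surjective f /\
    forall z, f z = 0 <-> exists y, y *m B = z.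

Lemma presents_ex (S : pzRingType) p q (B : 'M[S]_(p, q)) :
  exists M, finitely_generated M /\ presents B M.
Proof.
have [M [f [f_surj fE]]] := quotient_ex (submodule_im (row_mulmx B)).
exists M; split; last by exists f.
exact: finitely_generated_quo (finitely_generated_free S q) f_surj.
Qed.

Lemma submodule_matrix (S : pzRingType) p (U : 'rV[S]_p -> Prop) :
  noetherian S^o -> submodule U ->
  exists r (C : 'M[S]_(r, p)), forall z, U z <-> exists y, y *m C = z.
Proof.
move=> noS sU.
have noP := noetherian_finitely_generated noS (finitely_generated_free S p).
have [//|r [e [Ue eE]]] := noP U sU; exists r, (\matrix_i e i) => z.
split=> [/eE[c ->]|[y <-]].
  by exists (\row_i c i); rewrite mulmx_sum_row; apply: eq_bigr => i _; rewrite mxE rowK.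
rewrite mulmx_sum_row; apply: submodule_sum => // i _; apply: submoduleZ => //.
by rewrite rowK.
Qed.

Lemma row_kernel_ex (S : pzRingType) p q (B : 'M[S]_(p, q)) :
  noetherian S^o -> exists r (C : 'M[S]_(r, p)), row_exact C B.
Proof. by move=> noS; exact: (submodule_matrix noS (submodule_ker (row_mulmx B))). Qed.

Lemma presented_ex (S : pzRingType) (K : lmodType S) :
  noetherian S^o -> finitely_generated K ->
  exists p q (B : 'M[S]_(p, q)), presents B K.
Proof.
move=> noS /free_cover_ex[q [f f_surj]].
have [p [B BE]] := submodule_matrix noS (submodule_ker f).
by exists p, q, B, f.
Qed.

Lemma presents_syzygy (S : pzRingType) r p q (C : 'M[S]_(r, p)) (B : 'M[S]_(p, q))
    (M K : lmodType S) :
  row_exact C B -> presents B M -> presents C K -> proj_syzygy M K.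
Proof.
move=> CB [f [f_surj fE]] [g [g_surj gE]].
have [z /gE/CB//|j jE] := descend_along (h := mulmxr B) g_surj.
exists 'rV_q, f, j; split=> //.
- exact: finitely_generated_free.
- exact: projective_free.
- apply: linear_injP => x; have [z <-] := g_surj x.
  by rewrite jE => /CB/gE.
- move=> z; rewrite fE; split=> [[y <-]|[x <-]]; first by exists (g y); rewrite jE.
  by have [y <-] := g_surj x; exists y; rewrite jE.
Qed.

(** Dualizing preserves exactness at [p] when [Ext^1(M, S) = 0], where [M] is the
    cokernel of [B]: a column killed by [C] is a linear form on [S^p] that descends
    to the image of [B], hence extends to [S^q], that is, has the form [B *m y]. *)
Lemma row_exact_col (S : pzRingType) (I : nat -> lmodType S)
    (eps : {linear S^o -> I 0%N}) (d : forall i, {linear I i -> I i.+1})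
    r p q (C : 'M[S]_(r, p)) (B : 'M[S]_(p, q)) (M : lmodType S) :
  injective_coresolution eps d -> presents B M -> ext_vanish d 0 M ->
  row_exact C B -> col_exact C B.
Proof.
move=> res [f [f_surj fE]] extM CB x; split=> [Cx|[y <-]]; last first.
  apply/row_matrixP => i; rewrite row_mul mulmxA (_ : row i C *m B = 0).
    by rewrite mul0mx row0.
  by apply/CB; exists (delta_mx 0 i); rewrite -rowE.
have [phi phiE] : exists phi : {linear 'rV[S]_p -> S^o}, forall z, phi z = (z *m x) 0 0.
  by apply: linear_map_ex => a y z; rewrite mulmxDl -scalemxAl !mxE.
have [W [e [i [e_surj i_inj ie]]]] := image_ex (row_mulmx B).
have [z ez|psi psiE] := descend_along (h := phi) e_surj.
  have /CB[y <-] : z *m B = 0 by rewrite -[LHS]ie ez linear0.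
  by rewrite phiE -mulmxA Cx mulmx0 mxE.
have exW : exact i f.
  move=> z; rewrite fE; split=> [[y <-]|[w <-]]; first by exists (e y); rewrite ie.
  by have [y <-] := e_surj w; exists y; rewrite ie.
have [chi chiE] :=
  ext_vanish_extend res psi (projective_free (S := S) (m := q)) f_surj i_inj exW extM.
have [y yE] := free_linear_form chi; exists y; apply/colP => k.
have := chiE (e (delta_mx 0 k)); rewrite psiE phiE ie yE /= -mulmxA -!rowE !mxE.
by [].
Qed.

(** * Gorenstein duality and the theorem *)

(** [M] is the transpose of [K]. If [Ext^j(K, A) = 0] for all [j > 0], the dual of a free
    resolution of [K] is exact, so [M] is a syzygy of the transpose of the syzygy of
    [K], and so on: [M] is a [t]-th syzygy for every [t]. As [A] has injective
    dimension at most [n] on the other side, Ext vanishes on [n]-th syzygies. *)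
Lemma transpose_ext_vanish (A : pzRingType)
    (I : nat -> lmodType A) (eps : {linear A^o -> I 0%N})
    (d : forall i, {linear I i -> I i.+1})
    (I' : nat -> lmodType A^c) (eps' : {linear (A^c)^o -> I' 0%N})
    (d' : forall i, {linear I' i -> I' i.+1}) n :
  injective_coresolution eps d -> injective_coresolution eps' d' ->
  (forall i, (n < i)%N -> forall x : I i, x = 0) -> noetherian (A^c)^o ->
  forall t p q (B : 'M[A]_(p, q)) (K : lmodType A^c) (M : lmodType A),
  presents (converse_tr B) K -> (forall i, ext_vanish d' i K) -> presents B M ->
  forall i, (n <= t + i)%N -> ext_vanish d i M.
Proof.
move=> res res' I0 noA; elim=> [|t IHt] p q B K M BK extK BM i ni.
  exact: ext_vanish_beyond ni.
have [r [D DB]] := row_kernel_ex (converse_tr B) noA.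
have [K' [_ DK']] := presents_ex D.
have extK' j : ext_vanish d' j K'.
  exact: (ext_vanish_syzygy res' (presents_syzygy DB BK DK')).
pose B' : 'M[A]_(q, r) := D^T.
have B'E : converse_tr B' = D by apply: trmxK.
have BB' : row_exact B B'.
  apply: col_exact_untr; rewrite B'E.
  exact: row_exact_col res' BK (extK 0%N) DB.
have [M' [_ B'M']] := presents_ex B'.
apply: (ext_vanish_syzygy res (presents_syzygy BB' B'M' BM)).
by apply: (IHt _ _ B' K') => //; rewrite ?B'E // addnS.
Qed.

(** Resolve the transpose [M] of [K] instead, [C] being the next matrix. As Ext vanishes
    on [M], the dual is exact, which embeds [K] in a free module with cokernel the
    transpose of a syzygy of [M]. That syzygy inherits the hypothesis, so the step
    can be repeated. *)
Lemma iterated_cosyzygy_ex (A : pzRingType)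
    (I : nat -> lmodType A) (eps : {linear A^o -> I 0%N})
    (d : forall i, {linear I i -> I i.+1}) :
  injective_coresolution eps d -> noetherian A^o ->
  forall k p q (B : 'M[A]_(p, q)) (K : lmodType A^c) (M : lmodType A),
  presents (converse_tr B) K -> presents B M -> (forall i, ext_vanish d i M) ->
  exists N, finitely_generated N /\ iter_proj_syzygy k N K.
Proof.
move=> res noA; elim=> [|k IHk] p q B K M BK BM extM.
  exists K; split=> //; have [f [f_surj _]] := BK.
  exact: finitely_generated_quo (finitely_generated_free _ _) f_surj.
have [r [C CB]] := row_kernel_ex B noA.
have [M' [_ CM']] := presents_ex C.
have [L [_ CL]] := presents_ex (converse_tr C).
have BC := col_exact_tr (row_exact_col res BM (extM 0%N) CB).
have [|N [fgN NL]] := IHk _ _ C L M' CL CM'.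
  by move=> i; apply: (ext_vanish_syzygy res (presents_syzygy CB BM CM')).
by exists N; split=> //; exists L => //; apply: presents_syzygy BC CL BK.
Qed.

Lemma enat_inf_leP (U : set nat) m :
  enat_le_nat (enat_inf U) m <-> exists2 k, U k & (k <= m)%N.
Proof.
rewrite /enat_inf; case: pselect => [U_ex|noU] /=; last first.
  by split=> // -[k Uk _]; case: noU; exists k; apply/asboolP.
case: ex_minnP => j /asboolP Uj jmin; split=> [jm|[k Uk]]; first by exists j.
by apply: leq_trans; apply/jmin/asboolP.
Qed.

Lemma enat_infP (U : set nat) n :
  enat_inf U = Some n <-> U n /\ forall m, U m -> (n <= m)%N.
Proof.
rewrite /enat_inf; case: pselect => [U_ex|noU] /=; last first.
  by split=> // -[Un _]; case: noU; exists n; apply/asboolP.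
case: ex_minnP => j /asboolP Uj jmin; split=> [[<-]|[Un nmin]].
  by split=> // m Um; apply/jmin/asboolP.
congr Some; apply/eqP; rewrite eqn_leq nmin // andbT.
exact/jmin/asboolP.
Qed.

Lemma injective_resolutionE (S : pzRingType) (E : lmodType S) n :
  injective_resolution E n ->
  exists (I : nat -> lmodType S) (eps : {linear E -> I 0%N})
    (d : forall i, {linear I i -> I i.+1}),
  injective_coresolution eps d /\ forall i, (n < i)%N -> forall x : I i, x = 0.
Proof. by move=> [I [eps [d [? ? ? ? ?]]]]; exists I, eps, d. Qed.

Theorem theorem3p15 (R : comPzRingType) (A : algType R) (n : nat) :
  artin_algebra A -> n_Gorenstein A n -> Dell A = Some n.
Proof.
move=> /artin_algebra_chain[dccA noA dccA' noA'].
move=> [/enat_infP[resr minr] /enat_infP[resl minl]].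
have [I [eps [d [res I0]]]] := injective_resolutionE resl.
have [I' [eps' [d' [res' I'0]]]] := injective_resolutionE resr.
apply/enat_infP; split=> [_ [M fgM ->]|m Dm].
  (* Upper bound: the n-th syzygy [K] of [M] is an (n+1)-st syzygy. *)
  apply/enat_inf_leP; exists n => //.
  have [K MK] := iter_syzygy_ex n dccA' noA' fgM.
  have fgK := finitely_generated_iter_syzygy noA' fgM (iter_syzygy_proj MK).
  have extK i : ext_vanish d' i K.
    apply/(ext_vanish_iter_syzygy res' i (iter_syzygy_proj MK)).
    by apply: (ext_vanish_beyond (n := n)); rewrite ?leq_addr.
  have [p [q [D DK]]] := presented_ex noA' fgK.
  pose B : 'M[A]_(q, p) := D^T.
  have BK : presents (converse_tr B) K by rewrite /converse_tr trmxK.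
  have [T [_ BT]] := presents_ex B.
  have extT i : ext_vanish d i T.
    by apply: (transpose_ext_vanish res res' I0 noA' (t := n) BK) => //; rewrite leq_addr.
  have [N [fgN NK]] := iterated_cosyzygy_ex res noA n.+1 BK BT extT.
  have [L NL] := iter_syzygy_ex n.+1 dccA' noA' fgN.
  exists N, K, L; split=> //.
  exact: stable_iso_summand (stable_iso_iter_syzygy NK (iter_syzygy_proj NL)).
(* Lower bound: if [m < n] bounds all delooping levels, Ext^n(M, A) vanishes for
   every finitely generated [M], and the injective resolution can be shortened. *)
rewrite leqNgt; apply/negP => lt_mn.
case: n => [//|n] in minr I'0 lt_mn {resr minl resl I0} *.
suff /minr : injective_resolution (A^c)^o n by rewrite ltnn.
apply: (injective_resolution_shorten res') => M fgM.
have /enat_inf_leP[k [N [K [L [fgN MK NL KL]]]] km] : enat_le_nat (dell M) m.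
  by apply: Dm; exists M.
have kn : (k <= n)%N by apply: leq_trans km _.
rewrite -(subnKC kn); apply/(ext_vanish_iter_syzygy res' _ (iter_syzygy_proj MK)).
apply: (ext_vanish_summand res' KL).
apply/(ext_vanish_iter_syzygy res' _ (iter_syzygy_proj NL)).
by apply: (ext_vanish_beyond (n := n.+1)); rewrite ?addSn ?subnKC.
Qed.
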